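(* Let $n$ and $d$ be natural numbers. Suppose that either (a) $n\leq 2$ and $d$ is even, or (b) $d=2$ and $n$ is arbitrary, or (c) $(n,d)=(3,4)$. Then every positive definite form of $P_{n,d}$ is a coercive sum of squares.
   Context: A form is a homogeneous polynomial; all polynomials are taken to be forms. $P_{n,d}$ denotes the set of forms $f\in\mathbb{R}[x_1,\ldots,x_n]$ of degree $d$ that are nonnegative on $\mathbb{R}^n$. A form $f$ is positive definite if $f(\mathbf{a})>0$ for all $\mathbf{a}\in\mathbb{R}^n\setminus\{\mathbf{0}\}$. A form $f\in\mathbb{R}[x_1,\ldots,x_n]$ is a coercive sum of squares if there exists a representation $f=\sum_{j=1}^r p_j^2$ with $p_1,\ldots,p_r\in\mathbb{R}[x_1,\ldots,x_n]$ such that the system $p_1=\cdots=p_r=0$ has no solution $\mathbf{a}\in\mathbb{C}^n\setminus\{\mathbf{0}\}$. *)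

(* Defs.v *)
From mathcomp Require Import all_boot all_order all_algebra.
From mathcomp Require Import reals complex mpoly.

Set Implicit Arguments.
Unset Strict Implicit.
Unset Printing Implicit Defensive.

Import Order.TTheory GRing.Theory Num.Theory.
Local Open Scope ring_scope.

(* Points of R^n and C^n are row vectors [a]; the partial application [a 0]
   is then the coordinate function expected by polynomial evaluation. *)

(* Membership in P_{n,d}. As [d.-homog] holds of the zero polynomial for every
   [d], the zero form belongs to every P_{n,d}. *)
Definition psd_form (R : realType) (n d : nat) (f : {mpoly R[n]}) : Prop :=
  f \is d.-homog /\ forall a : 'rV[R]_n, 0 <= f.@[a 0].

Definition positive_definite (R : realType) (n : nat) (f : {mpoly R[n]}) : Prop :=
  forall a : 'rV[R]_n, a != 0 -> 0 < f.@[a 0].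

(* The p_j are forms too, of a priori arbitrary degrees; [real_complex R] is
   the embedding of R into R[i]. *)
Definition coercive_sos (R : realType) (n : nat) (f : {mpoly R[n]}) : Prop :=
  exists (r : nat) (p : 'I_r -> {mpoly R[n]}),
    [/\ forall j, p j \is homog mdeg,
        f = \sum_(j < r) p j ^+ 2
      & ~ exists2 a : 'rV[R[i]]_n, a != 0
            & forall j, (map_mpoly (real_complex R) (p j)).@[a 0] = 0].

(* Main.v *)
Require Import Defs.
From mathcomp Require Import all_boot all_order all_algebra reals.
From mathcomp Require mpoly.
From mathcomp Require Import boolp classical_sets topology normedtype derive.
From mathcomp Require Import complex ring lra.

Import -(notations) mpoly.
Import Order.TTheory GRing.Theory Num.Theory numFieldNormedType.Exports.

(** A positive definite form f of degree 2m stays nonnegative after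
    subtraction of e (x_1^2m + ... + x_n^2m) for some e > 0, because the unit
    sphere is compact.  In each of the three cases every nonnegative form is a
    sum of squares of forms (Hilbert, [psd_sos]); applied to the difference,
    this writes f as a sum of squares containing all the e x_i^2m, and these
    have no common complex zero besides the origin.

    The binary and quartic cases rest on one move, [touching_multiple]: from a
    nonnegative form F subtract the largest multiple of a positive form N of
    the same degree that keeps F nonnegative.  The difference has a nontrivial
    real zero b, and the zero can be used to factor.

    - Binary forms ([psd_binary_sos]): take N = (y^2 + z^2)^m.  The difference
      is the square of the linear form vanishing at b times a nonnegative form
      of smaller degree.
    - Quadratic forms ([psd_quadratic_sos]): complete the square in the last
      variable.
    - Ternary quartics ([psd_ternary_quartic_sos]), along the lines of Choi and
      Lam.  After a first touching and a change of coordinates F vanishes at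
      (0,0,1), so F = q x^2 + 2 c x + g, where x is the last variable, with
      binary forms q, c, g of degrees 2, 3, 4 in the others, and q >= 0,
      g >= 0, q g - c^2 >= 0.  If q has a zero, it is a multiple of the square
      of a linear form and completing the square leaves a nonnegative binary
      quartic.  If q is positive definite, let q g - c^2 touch a multiple e q^3:
      then F - e q^2 is nonnegative and has a second zero.  A shift of x by a
      linear form in the other variables moves this zero to x = 0, which gives
      F - e q^2 = X^2 q + 2 X l c' + l^2 g' with l linear and q, c', g' binary
      quadratic.  One last touching, for the determinant q g' - c'^2, makes this
      expression, up to sums of squares, a square plus a nonnegative binary
      quadratic form times a square ([psd_biquadratic_sos]).

    All of this is done with functions on the space of real sequences, where
    algebraic identities and substitutions are immediate; a polynomial over an
    infinite field is determined by its values ([mpoly_eval_eq0]), which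
    brings the identities back to polynomials. *)

Section PsdForms.
Set Implicit Arguments.
Unset Strict Implicit.
Unset Printing Implicit Defensive.
Local Open Scope classical_set_scope.
Local Open Scope ring_scope.
Context {R : realType}.

(** * Forms as functions *)

(** The polynomial functions given by forms of degree d in the first n
    coordinates.  Points are sequences, so that n can vary without changing the
    type of the functions.  Degree d.+1 is generated by products of a coordinate
    and a form of degree d, which makes closure properties structural
    inductions; the zero form has every degree. *)
Inductive form (n : nat) : nat -> ((nat -> R) -> R) -> Prop :=
| form_const c : form n 0 (fun _ => c)
| form_zero d : form n d (fun _ => 0)
| form_add d F G :
    form n d F -> form n d G -> form n d (fun v => F v + G v)
| form_var d i F :
    (i < n)%N -> form n d F -> form n d.+1 (fun v => v i * F v).

Lemma form_ext n d F G : F =1 G -> form n d F -> form n d G.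
Proof. by move=> /funext ->. Qed.

Lemma form_scale n d c F : form n d F -> form n d (fun v => c * F v).
Proof.
elim=> [a|e|e A B _ IA _ IB|e i A lt_in _ IA]; first exact: form_const.
- by apply: form_ext (form_zero n e) => v; rewrite mulr0.
- by apply: form_ext (form_add IA IB) => v; rewrite mulrDr.
- by apply: form_ext (form_var lt_in IA) => v; rewrite mulrCA.
Qed.

Lemma form_sub n d F G :
  form n d F -> form n d G -> form n d (fun v => F v - G v).
Proof.
move=> fF fG; apply: form_ext (form_add fF (form_scale (-1) fG)) => v.
by rewrite mulN1r.
Qed.

Lemma form_mul n d e F G :
  form n d F -> form n e G -> form n (d + e) (fun v => F v * G v).
Proof.
move=> + fG; elim=> [a|k|k A B _ IA _ IB|k i A lt_in _ IA].
- exact: form_scale.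
- by apply: form_ext (form_zero n (k + e)) => v; rewrite mul0r.
- by apply: form_ext (form_add IA IB) => v; rewrite mulrDl.
- by apply: form_ext (form_var lt_in IA) => v; rewrite mulrA.
Qed.

Lemma form_coord n i : (i < n)%N -> form n 1 (fun v => v i).
Proof.
move=> lt_in; apply: form_ext (form_var lt_in (form_const n 1)) => v.
by rewrite mulr1.
Qed.

Lemma form_exp n d k F : form n d F -> form n (k * d) (fun v => F v ^+ k).
Proof.
move=> fF; elim: k => [|k IH]; first exact: form_const.
by apply: form_ext (form_mul fF IH) => v; rewrite exprS.
Qed.

Lemma form_sum n d (I : Type) (s : seq I) (P : pred I) F :
  (forall i, P i -> form n d (F i)) ->
  form n d (fun v => \sum_(i <- s | P i) F i v).
Proof.
move=> fF; elim: s => [|i s IH].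
  by apply: form_ext (form_zero n d) => v; rewrite big_nil.
case Pi: (P i); last by apply: form_ext IH => v; rewrite big_cons Pi.
by apply: form_ext (form_add (fF i Pi) IH) => v; rewrite big_cons Pi.
Qed.

Lemma form_const_eq n F : form n 0 F -> exists c, forall v, F v = c.
Proof.
move d0: 0%N => d fF; elim: fF d0 => //.
- by move=> c _; exists c.
- by move=> e _; exists 0.
move=> e A B _ IF _ IG d0; have [[a Fa] [b Gb]] := (IF d0, IG d0).
by exists (a + b) => v; rewrite Fa Gb.
Qed.

Lemma form_widen n m d F : (n <= m)%N -> form n d F -> form m d F.
Proof.
move=> le_nm; elim=> *; [exact: form_const | exact: form_zero
  | exact: form_add | apply: form_var => //; exact: (leq_trans _ le_nm)].
Qed.

Lemma form_local n d F u v :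
  form n d F -> (forall i, (i < n)%N -> u i = v i) -> F u = F v.
Proof.
move=> fF uv.
by elim: fF => // [e A B _ -> _ ->|e i A lt_in _ ->] //; rewrite uv.
Qed.

Lemma form_homog n d F t v :
  form n d F -> F (fun i => t * v i) = t ^+ d * F v.
Proof.
elim=> [c|e|e A B _ -> _ ->|e i A lt_in _ ->].
- by rewrite mul1r.
- by rewrite mulr0.
- by rewrite mulrDr.
- by rewrite exprS mulrACA.
Qed.

(** Linear substitutions preserve degrees. *)
Lemma form_comp n m d F (L : (nat -> R) -> nat -> R) :
  (forall i, (i < n)%N -> form m 1 (fun v => L v i)) ->
  form n d F -> form m d (fun v => F (L v)).
Proof.
move=> fL; elim=> [c|e|e A B _ IA _ IB|e i A lt_in _ IA].
- exact: form_const.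
- exact: form_zero.
- exact: form_add.
- exact: form_mul (fL i lt_in) IA.
Qed.

Lemma form_continuous n d F (T : topologicalType) (u : T -> nat -> R) :
  form n d F -> (forall i, continuous (fun t => u t i)) ->
  continuous (fun t => F (u t)).
Proof.
move=> fF cu; elim: fF => [c|e|e A B _ IA _ IB|e i A _ _ IA] t.
- exact: cvg_cst.
- exact: cvg_cst.
- exact: (cvgD (IA t) (IB t)).
- exact: (cvgM (cu i t) (IA t)).
Qed.

(** Expansion of F in powers of its last coordinate, one power at a time. *)
Lemma form_split n d F : form n.+1 d F -> exists2 H, form n d H &
  if d is e.+1 then exists2 G, form n.+1 e G &
    forall v, F v = v n * G v + H v
  else forall v, F v = H v.
Proof.
elim=> {F} [c|{}d|{}d A B _ [HA fHA IA] _ [HB fHB IB]|{}d i A lt_in fA [H fH IA]].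
- by exists (fun _ => c) => //; exact: form_const.
- exists (fun _ => 0); first exact: form_zero.
  case: d => // d; exists (fun _ => 0); first exact: form_zero.
  by move=> v; rewrite mulr0 addr0.
- exists (fun v => HA v + HB v); first exact: form_add.
  case: d fHA fHB IA IB => [|d] _ _ => [IA IB v|]; first by rewrite IA IB.
  case=> GA fGA IA [GB fGB IB]; exists (fun v => GA v + GB v).
    exact: form_add.
  by move=> v; rewrite IA IB; ring.
move: lt_in; rewrite ltnS leq_eqVlt => /orP[/eqP->|lt_in].
  exists (fun _ => 0); first exact: form_zero.
  by exists A => // v; rewrite addr0.
exists (fun v => v i * H v); first exact: form_var.
case: d fA fH IA => [|d] fA fH IA.
  exists (fun _ => 0); first exact: form_zero.
  by move=> v; rewrite mulr0 add0r IA.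
case: IA => G fG IA; exists (fun v => v i * G v).
  by apply: form_var => //; exact: ltnW.
by move=> v; rewrite IA; ring.
Qed.

(** * Touching multiples *)

Definition nonzero_below n (v : nat -> R) := exists2 i, (i < n)%N & v i != 0.

(** Compactness is available for row vectors; this extends a row vector by
    zeros to a point of the sequence space. *)
Definition row_point n (a : 'rV[R]_n) (i : nat) : R :=
  if insub i is Some j then a 0 j else 0.

Lemma row_pointE n (a : 'rV[R]_n) (j : 'I_n) : row_point a j = a 0 j.
Proof.
rewrite /row_point (insubT (fun k => k < n)%N (ltn_ord j)) /=.
by congr (a 0 _); apply: val_inj.
Qed.

Lemma row_point_continuous n i : continuous (fun a : 'rV[R]_n => row_point a i).
Proof.
rewrite /row_point; case: insub => [j|]; first exact: coord_continuous.
by move=> a; apply: cst_continuous.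
Qed.

Lemma row_point_nonzero n (a : 'rV[R]_n) :
  a != 0 -> nonzero_below n (row_point a).
Proof.
by move=> /rV0Pn[j aj0]; exists j; rewrite ?row_pointE.
Qed.

Lemma unit_sphere_compact n : compact [set a : 'rV[R]_n | `|a| = 1].
Proof.
apply: bounded_closed_compact.
  exists 1; split; first exact: num_real.
  by move=> M lt1M a /= ->; exact: ltW.
apply: (@closed_comp _ _ (fun a : 'rV[R]_n => `|a|) [set 1]).
  by move=> a _; exact: norm_continuous.
exact: closed_eq.
Qed.

(** The quotient F / N is invariant under scaling, so its minimum over the
    compact unit sphere is its minimum over all nonzero points; eps is that
    minimum and b a point where it is attained. *)
Lemma touching_multiple n d F N :
  form n.+1 d F -> form n.+1 d N -> (forall v, 0 <= F v) ->
  (forall v, nonzero_below n.+1 v -> 0 < N v) ->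
  exists eps b, [/\ 0 <= eps, nonzero_below n.+1 b,
    forall v, eps * N v <= F v & F b = eps * N b].
Proof.
move=> fF fN F_ge0 N_gt0.
pose K := [set a : 'rV[R]_n.+1 | `|a| = 1].
have Knz a : K a -> nonzero_below n.+1 (row_point a).
  move=> Ka; apply: row_point_nonzero; apply/eqP => a0.
  by move: Ka; rewrite /K /= a0 normr0 => /eqP; rewrite eq_sym oner_eq0.
have scaleK (a : 'rV[R]_n.+1) : a != 0 -> K (`|a|^-1 *: a).
  by move=> a0; rewrite /K /= normrZ normfV normr_id mulVf // normr_eq0.
have K0 : K !=set0.
  exists (`|const_mx 1 : 'rV[R]_n.+1|^-1 *: const_mx 1); apply: scaleK.
  by apply/rV0Pn; exists ord0; rewrite mxE oner_eq0.
pose G (a : 'rV[R]_n.+1) := F (row_point a) / N (row_point a).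
have cont H : form n.+1 d H -> continuous (fun a : 'rV[R]_n.+1 => H (row_point a)).
  by move=> fH; apply: (form_continuous fH) => i; exact: row_point_continuous.
have cG : {within K, continuous G}.
  apply: continuous_in_subspaceT => a /set_mem Ka.
  apply: (@continuousM _ _ (fun a => F (row_point a))
    (fun a => (N (row_point a))^-1)); first exact: cont.
  apply: continuousV; last exact: cont.
  by rewrite gt_eqF // N_gt0 //; exact: Knz.
have [a /set_mem Ka minG] := compact_EVT_min K0 (@unit_sphere_compact _) cG.
have Na := N_gt0 _ (Knz _ Ka).
have Fa : F (row_point a) = G a * N (row_point a) by rewrite divfK // gt_eqF.
exists (G a), (row_point a); split => //.
- by rewrite divr_ge0 // ltW.
- exact: Knz.
move=> v; pose w : 'rV[R]_n.+1 := \row_i v i.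
have vw k : (k < n.+1)%N -> v k = row_point w k.
  by move=> lt_in; rewrite -[k]/(val (Ordinal lt_in)) row_pointE mxE.
(* At a point with vanishing coordinates both forms take the value
   0 ^+ d times their value at the minimum, also when d = 0. *)
have [w0|w0] := eqVneq w 0.
  have v0 H : form n.+1 d H -> H v = 0 ^+ d * H (row_point a).
    move=> fH; rewrite -(form_homog _ _ fH); apply: (form_local fH) => k lt_in.
    by rewrite vw // w0 -[k]/(val (Ordinal lt_in)) row_pointE mxE mul0r.
  by rewrite (v0 F) // (v0 N) // Fa mulrCA.
set u := `|w|^-1 *: w.
have nw_gt0 : 0 < `|w| by rewrite normr_gt0.
have vu H : form n.+1 d H -> H v = `|w| ^+ d * H (row_point u).
  move=> fH; rewrite -(form_homog _ _ fH); apply: (form_local fH) => k lt_in.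
  rewrite vw // -[k]/(val (Ordinal lt_in)) !row_pointE [u _ _]mxE mulrA divff ?mul1r //.
  by rewrite gt_eqF.
have Ku : K u by exact: scaleK.
rewrite (vu F) // (vu N) // mulrCA ler_pM2l ?exprn_gt0 //.
rewrite -ler_pdivlMr; last by apply: N_gt0; exact: Knz.
exact/minG/mem_set.
Qed.

Lemma continuous_ge0_at0 (h : R -> R) :
  continuous h -> (forall t, 0 < t -> 0 <= h t) -> 0 <= h 0.
Proof.
move=> ch h_ge0; rewrite leNgt; apply/negP => h0_lt0.
have := ch 0; move=> /(_ [set x | x < 0]) /=.
have nb : nbhs (h 0) [set x : R | x < 0] by exact: lt_nbhsl.
move=> /(_ nb) /nbhs_ballP[e /= e_gt0 sub].
have lt0 : h (e / 2) < 0.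
  by apply: sub; rewrite /ball /= sub0r normrN gtr0_norm ?divr_gt0 //; lra.
by move: lt0; rewrite ltNge h_ge0 // divr_gt0.
Qed.

(** * Division of binary forms by linear forms *)

(** The determinant of (v, b) in the first two coordinates, whose zeros are the
    multiples of b when b is nonzero there. *)
Definition lin_through (b v : nat -> R) := b 1%N * v 0%N - b 0%N * v 1%N.

Lemma lin_through_form b : form 2 1 (lin_through b).
Proof. by apply: form_sub; apply: form_scale; exact: form_coord. Qed.

Lemma lin_through_self b : lin_through b b = 0.
Proof. by rewrite /lin_through; ring. Qed.

Lemma nonzero_below2 (b : nat -> R) :
  nonzero_below 2 b -> 0 < b 0%N ^+ 2 + b 1%N ^+ 2.
Proof.
case=> [[|[|//]]] _ b0.
  by rewrite ltr_wpDr ?sqr_ge0 // exprn_even_gt0.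
by rewrite ltr_wpDl ?sqr_ge0 // exprn_even_gt0.
Qed.

(** The form [lin_through b] and the form w with w(b) = 1 below are linear
    coordinates on the plane; in them, a form of positive degree is
    the sum of a multiple of the first and of a scalar multiple of a power of w. *)
Lemma binary_adapted_coords b d G :
  nonzero_below 2 b -> form 2 d G -> exists c,
  if d is e.+1 then exists2 H, form 2 e H & forall v,
    G v = lin_through b v * H v
          + c * ((b 0%N * v 0%N + b 1%N * v 1%N) / (b 0%N ^+ 2 + b 1%N ^+ 2)) ^+ d
  else forall v, G v = c.
Proof.
move=> /nonzero_below2 n_gt0.
set n := b 0%N ^+ 2 + _ in n_gt0 *.
have n_neq0 : n != 0 by rewrite gt_eqF.
pose w (v : nat -> R) := (b 0%N * v 0%N + b 1%N * v 1%N) / n.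
have fw : form 2 1 w.
  apply: (@form_ext _ _ (fun v => n^-1 * (b 0%N * v 0%N + b 1%N * v 1%N))).
    by move=> v; rewrite mulrC.
  by apply: form_scale; apply: form_add; apply: form_scale; exact: form_coord.
elim=> {d G} [c|d|d A B _ [x IA] _ [y IB]|d i A lt_i fA [c IA]].
- by exists c.
- exists 0; case: d => [//|d].
  by exists (fun _ => 0) => [|v]; [exact: form_zero | rewrite mulr0 mul0r addr0].
- exists (x + y); case: d IA IB => [IA IB v|d [H fH IA] [K fK IB]].
    by rewrite IA IB.
  exists (fun v => H v + K v) => [|v]; first exact: form_add.
  by rewrite IA IB; ring.
(* Coordinates of v i with respect to [lin_through b] and w. *)
pose al := if i is 0%N then b 1%N / n else - b 0%N / n.
have vi v : v i = al * lin_through b v + b i * w v.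
  case: i lt_i @al => [|[|//]] _ al; rewrite /al /w /lin_through /n;
    by field.
exists (c * b i); case: d fA IA => [|d] fA.
  move=> IA; exists (fun _ => c * al) => [|v]; first exact: form_const.
  by rewrite IA -!/(w v) vi expr1; ring.
case=> H fH IA; exists (fun v => v i * H v + c * al * w v ^+ d.+1) => [|v].
  apply: form_add; first exact: form_var.
  by apply: form_scale; have := form_exp d.+1 fw; rewrite muln1.
rewrite IA -!/(w v) mulrDr [in v i * (c * _)]vi.
by rewrite !exprS; ring.
Qed.

Lemma binary_factor b d G :
  nonzero_below 2 b -> form 2 d.+1 G -> G b = 0 ->
  exists2 H, form 2 d H & forall v, G v = lin_through b v * H v.
Proof.
move=> nzb fG Gb0; have [c [H fH GE]] := binary_adapted_coords nzb fG.
exists H => // v; rewrite GE; suff -> : c = 0 by rewrite mul0r addr0.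
move: (GE b); rewrite Gb0 lin_through_self mul0r add0r.
by rewrite -!expr2 divff ?gt_eqF ?nonzero_below2 // expr1n mulr1.
Qed.

(** Approach u along a segment transversal to the line through b. *)
Lemma binary_ge0_line b u d G : nonzero_below 2 b -> form 2 d G ->
  (forall v t, 0 < t ->
     lin_through b v = lin_through b u + t -> 0 <= G v) -> 0 <= G u.
Proof.
move=> /nonzero_below2 n_gt0 fG G_ge0.
set n := b 0%N ^+ 2 + _ in n_gt0.
(* The direction on which [lin_through b] takes the value 1. *)
pose bt i := if i is 0%N then b 1%N / n else - b 0%N / n.
pose h t := G (fun i => u i + t * bt i).
have -> : G u = h 0 by congr G; apply/funext => i; rewrite mul0r addr0.
apply: continuous_ge0_at0 => [|t t_gt0].
  apply: (form_continuous fG) => i t.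
  apply: cvgD; first exact: cvg_cst.
  by apply: cvgM; [exact: cvg_id | exact: cvg_cst].
apply: (G_ge0 _ t) => //; rewrite /lin_through /bt /n.
by field; rewrite gt_eqF.
Qed.

(** The hypothesis gives the sign off a line, which is dense. *)
Lemma binary_ge0_off_line b d G : nonzero_below 2 b -> form 2 d G ->
  (forall v, 0 <= lin_through b v ^+ 2 * G v) -> forall v, 0 <= G v.
Proof.
move=> nzb fG G_ge0 u.
have ge0_off v : lin_through b v != 0 -> 0 <= G v.
  by move=> lv; rewrite -(pmulr_rge0 _ (_ : 0 < lin_through b v ^+ 2)) // exprn_even_gt0.
have [lu|] := eqVneq (lin_through b u) 0; last exact: ge0_off.
apply: (binary_ge0_line nzb fG) => v t t_gt0 lv.
by apply: ge0_off; rewrite lv lu add0r gt_eqF.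
Qed.

(** The linear factor takes both signs arbitrarily close to b, and so would the
    product if G(b) were not 0. *)
Lemma binary_odd_zero b d G : nonzero_below 2 b -> form 2 d G ->
  (forall v, 0 <= lin_through b v * G v) -> G b = 0.
Proof.
move=> nzb fG G_ge0.
pose b' i := - b i.
have nzb' : nonzero_below 2 b' by case: nzb => i lt_i bi; exists i; rewrite ?oppr_eq0.
have lb' v : lin_through b' v = - lin_through b v by rewrite /lin_through /b'; ring.
apply/eqP; rewrite eq_le -oppr_ge0; apply/andP; split.
  rewrite -mulN1r; apply: (binary_ge0_line nzb' (form_scale (-1) fG)) => v t t_gt0.
  rewrite !lb' lin_through_self oppr0 add0r => lv.
  by rewrite -(pmulr_rge0 _ t_gt0) -lv; have := G_ge0 v; lra.
apply: (binary_ge0_line nzb fG) => v t t_gt0; rewrite lin_through_self add0r => lv.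
by rewrite -(pmulr_rge0 _ t_gt0) -lv.
Qed.

(** A nonnegative form cannot change sign across the line through its zero b, so
    [binary_odd_zero] makes the cofactor of the linear form vanish at b too. *)
Lemma binary_double_factor b d G :
  nonzero_below 2 b -> form 2 d.+2 G -> (forall v, 0 <= G v) -> G b = 0 ->
  exists H, [/\ form 2 d H, forall v, 0 <= H v &
    forall v, G v = lin_through b v ^+ 2 * H v].
Proof.
move=> nzb fG G_ge0 Gb.
have [H fH GH] := binary_factor nzb fG Gb.
have Hb : H b = 0 by apply: (binary_odd_zero nzb fH) => v; rewrite -GH.
have [K fK HK] := binary_factor nzb fH Hb.
have GK v : G v = lin_through b v ^+ 2 * K v by rewrite GH HK expr2 mulrA.
by exists K; split => //; apply: (binary_ge0_off_line nzb fK) => v; rewrite -GK.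
Qed.

(** * Sums of squares of forms *)

(** The squared forms have degree m in the first n coordinates.  Prepending one
    square at a time makes the closure properties inductions. *)
Inductive sos (n m : nat) : ((nat -> R) -> R) -> Prop :=
| sos_zero : sos n m (fun _ => 0)
| sos_cons p F : form n m p -> sos n m F -> sos n m (fun v => p v ^+ 2 + F v).

Lemma sos_ext n m F G : F =1 G -> sos n m F -> sos n m G.
Proof. by move=> /funext ->. Qed.

Lemma sos_sqr n m p : form n m p -> sos n m (fun v => p v ^+ 2).
Proof.
move=> fp; apply: sos_ext (sos_cons fp (sos_zero n m)) => v.
by rewrite addr0.
Qed.

Lemma sos_add n m F G : sos n m F -> sos n m G -> sos n m (fun v => F v + G v).
Proof.
move=> + sG; elim=> [|p A fp _ IA].
  by apply: sos_ext sG => v; rewrite add0r.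
by apply: sos_ext (sos_cons fp IA) => v; rewrite addrA.
Qed.

Lemma sos_scale n m c F : 0 <= c -> sos n m F -> sos n m (fun v => c * F v).
Proof.
move=> c_ge0; elim=> [|p A fp _ IA].
  by apply: sos_ext (sos_zero n m) => v; rewrite mulr0.
apply: sos_ext (sos_cons (form_scale (Num.sqrt c) fp) IA) => v.
by rewrite exprMn sqr_sqrtr // mulrDr.
Qed.

Lemma sos_mul_sqr n k m q F : form n k q -> sos n m F ->
  sos n (k + m) (fun v => q v ^+ 2 * F v).
Proof.
move=> fq; elim=> [|p A fp _ IA].
  by apply: sos_ext (sos_zero n (k + m)) => v; rewrite mulr0.
apply: sos_ext (sos_cons (form_mul fq fp) IA) => v.
by rewrite exprMn mulrDr.
Qed.

Lemma sos_comp n k m F (L : (nat -> R) -> nat -> R) :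
  (forall i, (i < n)%N -> form k 1 (fun v => L v i)) ->
  sos n m F -> sos k m (fun v => F (L v)).
Proof.
move=> fL; elim=> [|p A fp _ IA]; first exact: sos_zero.
exact: sos_cons (form_comp fL fp) IA.
Qed.

Lemma sos_widen n k m F : (n <= k)%N -> sos n m F -> sos k m F.
Proof.
move=> le_nk; elim=> [|p A fp _ IA]; first exact: sos_zero.
exact: sos_cons (form_widen le_nk fp) IA.
Qed.

(** * Binary forms *)

Lemma sos_circle_exp m : sos 2 m (fun v => (v 0%N ^+ 2 + v 1%N ^+ 2) ^+ m).
Proof.
elim: m => [|m IH].
  apply: sos_ext (sos_sqr (form_const 2 1)) => v; by rewrite expr0 expr1n.
have S i : (i < 2)%N -> sos 2 m.+1
    (fun v : nat -> R => v i ^+ 2 * (v 0%N ^+ 2 + v 1%N ^+ 2) ^+ m).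
  by move=> lt_i; apply: (sos_mul_sqr (form_coord lt_i) IH).
by apply: sos_ext (sos_add (S 0%N _) (S 1%N _)) => // v; rewrite [RHS]exprS mulrDl.
Qed.

Lemma circle_form : form 2 2 (fun v : nat -> R => v 0%N ^+ 2 + v 1%N ^+ 2).
Proof. by apply: form_add; apply: (@form_exp _ 1 2); exact: form_coord. Qed.

(** Induction on m: a touching multiple of (y^2 + z^2)^m leaves a square of a
    linear form times a nonnegative form of degree 2(m - 1). *)
Theorem psd_binary_sos m F :
  form 2 m.*2 F -> (forall v, 0 <= F v) -> sos 2 m F.
Proof.
elim: m F => [|m IH] F fF F_ge0.
  have [c Fc] := form_const_eq fF.
  have c_ge0 : 0 <= c by rewrite -(Fc (fun=> 0)).
  apply: sos_ext (sos_scale c_ge0 (sos_sqr (form_const 2 1))) => v.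
  by rewrite Fc expr1n mulr1.
have fN : form 2 m.+1.*2
    (fun v : nat -> R => (v 0%N ^+ 2 + v 1%N ^+ 2) ^+ m.+1).
  by rewrite -muln2; exact: form_exp circle_form.
have N_gt0 v : nonzero_below 2 v -> 0 < (v 0%N ^+ 2 + v 1%N ^+ 2 : R) ^+ m.+1.
  by move=> /nonzero_below2 nv; rewrite exprn_gt0.
have [eps [b [eps_ge0 nzb le_NF Fb]]] := touching_multiple fF fN F_ge0 N_gt0.
have [||G [fG G_ge0 FG]] :=
  binary_double_factor nzb (form_sub fF (form_scale eps fN)).
- by move=> v; rewrite subr_ge0.
- by apply/eqP; rewrite subr_eq0 Fb.
apply: sos_ext (sos_add (sos_scale eps_ge0 (sos_circle_exp m.+1))
  (sos_mul_sqr (lin_through_form b) (IH G fG G_ge0))) => v.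
by rewrite -FG addrC subrK.
Qed.

(** * Quadratic forms *)

Lemma quadratic_ge0 (a b c : R) :
  (forall x, 0 <= a * x ^+ 2 + b * x + c) ->
  [/\ 0 <= a, 0 <= c & b ^+ 2 <= 4 * a * c].
Proof.
move=> q_ge0.
have c_ge0 : 0 <= c by have := q_ge0 0; rewrite expr0n /= !mulr0 !add0r.
have a_ge0 : 0 <= a.
  rewrite leNgt; apply/negP => a_lt0.
  (* At this x the value is at most a x, which is negative. *)
  pose x := 1 + (`|b| + c) / - a.
  have x_gt0 : 0 < x by rewrite ltr_pwDl // divr_ge0 ?addr_ge0 // oppr_ge0 ltW.
  have x_ge1 : 1 <= x by rewrite lerDl divr_ge0 ?addr_ge0 // oppr_ge0 ltW.
  have ax : a * x = a - (`|b| + c) by rewrite /x; field; rewrite lt_eqF.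
  have le_bx : b * x <= `|b| * x by rewrite ler_pM2r // ler_norm.
  have le_cx : c <= c * x by rewrite ler_peMr.
  have : a * x < 0 by rewrite nmulr_rlt0.
  by have := q_ge0 x; rewrite expr2 mulrA ax; lra.
split => //; have [a0|a_neq0] := eqVneq a 0.
  have [->|b_neq0] := eqVneq b 0; first by rewrite a0 expr0n /=; lra.
  have := q_ge0 (- (c + 1) / b); rewrite a0 mul0r add0r mulrC divfK //; lra.
have a_gt0 : 0 < a by rewrite lt_neqAle eq_sym a_neq0.
have := q_ge0 (- b / (2 * a)).
have -> : a * (- b / (2 * a)) ^+ 2 + b * (- b / (2 * a)) + c
          = (4 * a * c - b ^+ 2) / (4 * a) by field.
by rewrite pmulr_lge0 ?invr_gt0 ?mulr_gt0 // subr_ge0.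
Qed.

Definition set_coord n (v : nat -> R) x i := if i == n then x else v i.

Lemma form_set_coord n d (F : (nat -> R) -> R) v x :
  form n d F -> F (set_coord n v x) = F v.
Proof.
move=> fF; apply: (form_local fF) => i lt_in.
by rewrite /set_coord ltn_eqF.
Qed.

(** Induction on n, completing the square in the last variable.  If its square
    has coefficient 0, nonnegativity makes F independent of this variable. *)
Theorem psd_quadratic_sos n (F : (nat -> R) -> R) :
  form n 2 F -> (forall v, 0 <= F v) -> sos n 1 F.
Proof.
elim: n F => [|n IH] F fF F_ge0.
  have -> : F = fun=> 0; last exact: sos_zero.
  apply/funext => v; rewrite (@form_local _ _ _ _ (fun i => 0 * v i) fF) //.
  by rewrite (form_homog _ _ fF) expr0n mul0r.
have [H fH [G fG FE]] := form_split fF.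
have [l fl [A fA GE]] := form_split fG.
have [a AE] := form_const_eq fA.
have FE' v : F v = a * v n ^+ 2 + l v * v n + H v by rewrite FE GE AE; ring.
have [a_ge0 H_ge0 disc] : [/\ 0 <= a, forall v, 0 <= H v
    & forall v, l v ^+ 2 <= 4 * a * H v].
  have q_ge0 v : [/\ 0 <= a, 0 <= H v & l v ^+ 2 <= 4 * a * H v].
    apply: quadratic_ge0 => x; have := F_ge0 (set_coord n v x).
    by rewrite FE' (form_set_coord _ _ fH) (form_set_coord _ _ fl) /set_coord eqxx.
  by split=> [|v|v]; [have [] := q_ge0 (fun=> 0) | have [] := q_ge0 v
    | have [] := q_ge0 v].
have [a0|a_neq0] := eqVneq a 0.
  apply: (@sos_ext _ _ H); last by apply: (sos_widen _ (IH H fH H_ge0)).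
  move=> v; have := disc v; rewrite a0 mulr0 mul0r => l2.
  have /eqP : l v ^+ 2 = 0 by apply/eqP; rewrite eq_le l2 sqr_ge0.
  by rewrite sqrf_eq0 => /eqP l0; rewrite FE' a0 l0; ring.
pose K v := H v - (4 * a)^-1 * (l v * l v).
have fK : form n 2 K by apply: form_sub fH (form_scale _ (form_mul fl fl)).
have K_ge0 v : 0 <= K v.
  have -> : K v = (4 * a * H v - l v ^+ 2) / (4 * a) by rewrite /K; field.
  by rewrite divr_ge0 ?subr_ge0 // mulr_ge0.
have fX : form n.+1 1 (fun v => v n + (2 * a)^-1 * l v).
  apply: form_add; first exact: form_coord.
  by apply: form_scale; apply: form_widen fl.
have sK : sos n.+1 1 K by apply: sos_widen (IH K fK K_ge0).
apply: sos_ext (sos_add (sos_scale a_ge0 (sos_sqr fX)) sK) => v.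
by rewrite /K FE'; field.
Qed.

(** * Ternary quartics *)

(** A cubic with a nonzero leading coefficient a takes a negative value: at
    x = - (1 + m) / a, with m the sum of the absolute values of the lower
    coefficients of a^2 times the cubic, as a monic cubic in a x, the leading
    term dominates the others. *)
Lemma cubic_ge0 (a b c d : R) :
  (forall x, 0 <= a * x ^+ 3 + b * x ^+ 2 + c * x + d) -> a = 0.
Proof.
move=> p_ge0; apply/eqP/negPn/negP => a_neq0.
pose m := `|b| + `|c * a| + `|d * a ^+ 2|.
have m_ge0 : 0 <= m by rewrite !addr_ge0.
have := p_ge0 (- (1 + m) / a).
rewrite -(pmulr_rge0 _ (_ : 0 < a ^+ 2)) ?exprn_even_gt0 //.
have -> : a ^+ 2 * (a * (- (1 + m) / a) ^+ 3 + b * (- (1 + m) / a) ^+ 2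
    + c * (- (1 + m) / a) + d)
  = - (1 + m) ^+ 3 + b * (1 + m) ^+ 2 - (c * a) * (1 + m) + d * a ^+ 2 by field.
have lb := ler_norm b; have lc := ler_norm (- (c * a)); have ld := ler_norm (d * a ^+ 2).
rewrite normrN in lc.
have m2 : 0 <= (1 + m) ^+ 2 by rewrite sqr_ge0.
have mc : `|c * a| * (1 + m) <= `|c * a| * (1 + m) ^+ 2.
  by rewrite ler_wpM2l // expr2 ler_peMr //; lra.
have md : `|d * a ^+ 2| * 1 <= `|d * a ^+ 2| * (1 + m) ^+ 2.
  by rewrite ler_wpM2l // expr2; nra.
have hb : b * (1 + m) ^+ 2 <= `|b| * (1 + m) ^+ 2 by rewrite ler_wpM2r.
have hc : - (c * a) * (1 + m) <= `|c * a| * (1 + m) by rewrite ler_wpM2r //; lra.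
have pos : 0 < (1 + m) ^+ 2 by rewrite exprn_gt0 //; lra.
have e3 : (1 + m) ^+ 3 = (1 + m) ^+ 2 + `|b| * (1 + m) ^+ 2
   + `|c * a| * (1 + m) ^+ 2 + `|d * a ^+ 2| * (1 + m) ^+ 2.
  by rewrite /m; ring.
by rewrite e3; lra.
Qed.

Lemma form_at_zero n d (F : (nat -> R) -> R) v :
  form n d.+1 F -> ~ nonzero_below n v -> F v = 0.
Proof.
move=> fF v0; rewrite (@form_local _ _ _ _ (fun i => 0 * v i) fF).
  by rewrite (form_homog _ _ fF) expr0n mul0r.
move=> i lt_in; rewrite mul0r; apply/eqP/negPn/negP => vi0.
by apply: v0; exists i.
Qed.

(** The degree of G is positive, so that G also vanishes at the points where
    nothing is known of the sign of q. *)
Lemma form_ge0_of_mul n d e (q G : (nat -> R) -> R) :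
  form n d q -> form n e.+1 G ->
  (forall v, nonzero_below n v -> 0 < q v) ->
  (forall v, 0 <= q v * G v) -> forall v, 0 <= G v.
Proof.
move=> fq fG q_gt0 qG v; have [nzv|v0] := pselect (nonzero_below n v).
  by rewrite -(pmulr_rge0 _ (q_gt0 v nzv)).
by rewrite (form_at_zero fG v0).
Qed.

(** A nonnegative 2 x 2 symmetric matrix of binary quadratic forms, with entries
    q, c, g and q positive definite, defines a sum of squares.  Subtract from g the
    multiple e (y^2 + z^2) for which the determinant acquires a zero b.  Let
    al = - c(b) / q(b).  In terms of X' = X - al Y and Y, the off-diagonal and
    lower entries become forms c' and g' that both vanish at b, so c' = l m and
    g' = k l^2 with l linear, l(b) = 0 and k constant.  If k > 0 the remaining
    expression is k (Y l + X' m / k)^2 + X'^2 (q - m^2 / k); if k = 0 then m = 0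
    and it is X'^2 q. *)
Lemma psd_biquadratic_sos (q c g X Y : (nat -> R) -> R) :
  form 2 2 q -> form 2 2 c -> form 2 2 g -> form 3 1 X -> form 3 1 Y ->
  (forall v, nonzero_below 2 v -> 0 < q v) ->
  (forall v, c v ^+ 2 <= q v * g v) ->
  sos 3 2 (fun v : nat -> R =>
    X v ^+ 2 * q v + 2 * X v * Y v * c v + Y v ^+ 2 * g v).
Proof.
move=> fq fc fg fX fY q_gt0 disc.
have q_ge0 v : 0 <= q v.
  apply: (form_ge0_of_mul fq fq q_gt0) => u; exact: sqr_ge0.
pose circ (v : nat -> R) := v 0%N ^+ 2 + v 1%N ^+ 2.
have fcirc : form 2 2 circ := circle_form.
have [||e [b [e_ge0 nzb le_D Db]]] := touching_multiple
  (form_sub (form_mul fq fg) (form_mul fc fc)) (form_mul fq fcirc).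
- by move=> v; rewrite subr_ge0 -expr2.
- by move=> v nzv; rewrite mulr_gt0 ?q_gt0 // nonzero_below2.
have qb := q_gt0 b nzb.
pose al := - c b / q b.
pose c' v := c v + al * q v.
pose g' v := g v - e * circ v + 2 * al * c v + al ^+ 2 * q v.
have fc' : form 2 2 c' by apply: form_add fc (form_scale _ fq).
have fg' : form 2 2 g'.
  apply: form_add; last exact: form_scale.
  apply: form_add; last exact: form_scale.
  exact: form_sub fg (form_scale _ fcirc).
have c'b : c' b = 0 by rewrite /c' /al divfK ?subrr // gt_eqF.
have disc' v : q v * g' v - c' v ^+ 2
    = q v * g v - c v * c v - e * (q v * circ v) by rewrite /g' /c'; ring.
have disc'_ge0 v : c' v ^+ 2 <= q v * g' v by rewrite -subr_ge0 disc' subr_ge0.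
have g'_ge0 : forall v, 0 <= g' v.
  apply: (form_ge0_of_mul fq fg' q_gt0) => v.
  exact: le_trans (sqr_ge0 _) (disc'_ge0 v).
have g'b : g' b = 0.
  have := disc' b; rewrite c'b Db subrr expr0n subr0 => /eqP.
  by rewrite mulf_eq0 gt_eqF //= => /eqP.
have [m fm cm] := binary_factor nzb fc' c'b.
have [K [fK K_ge0 gK]] := binary_double_factor nzb fg' g'_ge0 g'b.
have [k KE] := form_const_eq fK.
have k_ge0 : 0 <= k by rewrite -(KE b).
have fl := lin_through_form b; set l := lin_through b in cm gK fl.
have disc_m v : 0 <= k * q v - m v * m v.
  move: v; apply: (binary_ge0_off_line nzb).
    exact: form_sub (form_scale _ fq) (form_mul fm fm).
  move=> v; have := disc'_ge0 v; rewrite -subr_ge0 gK cm KE -/l.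
  by congr (_ <= _); ring.
have fX' : form 3 1 (fun v => X v - al * Y v) by apply: form_sub fX (form_scale _ fY).
have s_circ : sos 3 2 (fun v => Y v ^+ 2 * circ v).
  apply: (@sos_mul_sqr _ 1 1) => //; apply: (@sos_widen 2) => //.
  by apply: psd_quadratic_sos => // v; rewrite addr_ge0 ?sqr_ge0.
have s_e := sos_scale e_ge0 s_circ.
have [k0|k_neq0] := eqVneq k 0.
  have s_q : sos 3 2 (fun v => (X v - al * Y v) ^+ 2 * q v).
    apply: (@sos_mul_sqr _ 1 1) => //; apply: (@sos_widen 2) => //.
    exact: psd_quadratic_sos.
  apply: sos_ext (sos_add s_e s_q) => v.
  have m0 : m v = 0.
    have := disc_m v; rewrite k0 mul0r add0r oppr_ge0 -expr2 => m2.
    by apply/eqP; rewrite -sqrf_eq0 eq_le m2 sqr_ge0.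
  have c'0 : c' v = 0 by rewrite cm m0 mulr0.
  have g'0 : g' v = 0 by rewrite gK KE k0 mulr0.
  transitivity (e * (Y v ^+ 2 * circ v) + ((X v - al * Y v) ^+ 2 * q v
    + 2 * (X v - al * Y v) * Y v * c' v + Y v ^+ 2 * g' v)).
    by rewrite c'0 g'0; ring.
  by rewrite /c' /g'; ring.
have k_gt0 : 0 < k by rewrite lt_neqAle eq_sym k_neq0.
have fp : form 3 2 (fun v => Y v * l v + k^-1 * ((X v - al * Y v) * m v)).
  apply: form_add; first by apply: (@form_mul _ 1 1) => //; apply: form_widen fl.
  apply: form_scale; apply: (@form_mul _ 1 1) => //; exact: form_widen fm.
have s_q : sos 3 2 (fun v => (X v - al * Y v) ^+ 2 * (k^-1 * (k * q v - m v * m v))).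
  apply: (@sos_mul_sqr _ 1 1) => //; apply: (@sos_widen 2) => //.
  apply: psd_quadratic_sos; last by move=> v; rewrite mulr_ge0 // invr_ge0.
  exact: form_scale (form_sub (form_scale _ fq) (form_mul fm fm)).
apply: sos_ext (sos_add s_e (sos_add (sos_scale k_ge0 (sos_sqr fp)) s_q)) => v.
transitivity (e * (Y v ^+ 2 * circ v) + ((X v - al * Y v) ^+ 2 * q v
    + 2 * (X v - al * Y v) * Y v * c' v + Y v ^+ 2 * g' v)).
  by rewrite cm gK KE -/l; field.
by rewrite /c' /g'; ring.
Qed.

(** The quartic F = q x^2 + 2 c x + g satisfies q F = (q x + c)^2 + (q g - c^2).
    Letting q g - c^2 touch e q^3 at b makes F - e q^2 nonnegative with a zero
    above b.  Once x is shifted so that this zero has x = 0, the coefficients of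
    x and of 1 are divisible by l and by l^2, where l vanishes at b, and
    [psd_biquadratic_sos] applies to the shifted x and l. *)
Lemma quartic_definite_sos (q c g : (nat -> R) -> R) :
  form 2 2 q -> form 2 3 c -> form 2 4 g ->
  (forall v, nonzero_below 2 v -> 0 < q v) ->
  (forall v, c v ^+ 2 <= q v * g v) ->
  sos 3 2 (fun v : nat -> R => q v * v 2%N ^+ 2 + 2 * c v * v 2%N + g v).
Proof.
move=> fq fc fg q_gt0 disc.
have fq3 : form 2 6 (fun v => q v ^+ 3) := form_exp 3 fq.
have [||e [b [e_ge0 nzb le_D Db]]] := touching_multiple
  (form_sub (form_mul fq fg) (form_mul fc fc)) fq3.
- by move=> v; rewrite subr_ge0 -expr2.
- by move=> v nzv; rewrite exprn_gt0 ?q_gt0.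
have qb := q_gt0 b nzb; have nb := nonzero_below2 nzb.
pose n := b 0%N ^+ 2 + b 1%N ^+ 2.
(* The linear form la takes the value - c(b) / q(b) at b, the abscissa of the
   zero above b. *)
pose la (v : nat -> R) :=
  - c b / q b / n * (b 0%N * v 0%N + b 1%N * v 1%N).
have fla : form 2 1 la.
  by apply: form_scale; apply: form_add; apply: form_scale; exact: form_coord.
have lab : la b = - c b / q b.
  by rewrite /la -!expr2 -/n divfK // gt_eqF.
pose c' v := c v + la v * q v.
pose g' v := g v - e * (q v * q v) + 2 * (la v * c v) + la v * (la v * q v).
have fc' : form 2 3 c' by apply: form_add fc (form_mul fla fq).
have fg' : form 2 4 g'.
  apply: form_add; last exact: form_mul fla (form_mul fla fq).
  apply: form_add; last exact: form_scale (form_mul fla fc).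
  exact: form_sub fg (form_scale _ (form_mul fq fq)).
have c'b : c' b = 0 by rewrite /c' lab divfK ?subrr // gt_eqF.
have disc' v : q v * g' v - c' v ^+ 2
    = q v * g v - c v * c v - e * q v ^+ 3 by rewrite /g' /c'; ring.
have disc'_ge0 v : c' v ^+ 2 <= q v * g' v by rewrite -subr_ge0 disc' subr_ge0.
have g'_ge0 : forall v, 0 <= g' v.
  apply: (form_ge0_of_mul fq fg' q_gt0) => v.
  exact: le_trans (sqr_ge0 _) (disc'_ge0 v).
have g'b : g' b = 0.
  have := disc' b; rewrite c'b Db subrr expr0n subr0 => /eqP.
  by rewrite mulf_eq0 gt_eqF //= => /eqP.
have [m fm cm] := binary_factor nzb fc' c'b.
have [k [fk k_ge0 gk]] := binary_double_factor nzb fg' g'_ge0 g'b.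
have fl := lin_through_form b.
have disc_m v : m v ^+ 2 <= q v * k v.
  rewrite -subr_ge0 expr2; move: v; apply: (binary_ge0_off_line nzb).
    exact: form_sub (form_mul fq fk) (form_mul fm fm).
  move=> v; have := disc'_ge0 v; rewrite -subr_ge0 gk cm.
  by congr (_ <= _); ring.
have fX : form 3 1 (fun v => v 2%N - la v).
  by apply: form_sub; [exact: form_coord | exact: form_widen fla].
have fl3 : form 3 1 (lin_through b) by exact: form_widen fl.
have fq_3 : form 3 2 q by exact: form_widen fq.
have s := psd_biquadratic_sos fq fm fk fX fl3 q_gt0 disc_m.
apply: sos_ext (sos_add (sos_scale e_ge0 (sos_sqr fq_3)) s) => v.
transitivity (e * q v ^+ 2 + ((v 2%N - la v) ^+ 2 * q v
    + 2 * (v 2%N - la v) * c' v + g' v)); first by rewrite cm gk; ring.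
by rewrite /c' /g'; ring.
Qed.

(** Here q = a l^2 with l the linear form vanishing at b, and c = l m, because
    c^2 <= q g forces c(b) = 0.  So F = a (l x + m / a)^2 + (g - m^2 / a), and
    the last term is a nonnegative binary quartic. *)
Lemma quartic_degenerate_sos (q c g : (nat -> R) -> R) b :
  form 2 2 q -> form 2 3 c -> form 2 4 g ->
  (forall v, 0 <= q v) -> (forall v, 0 <= g v) ->
  (forall v, c v ^+ 2 <= q v * g v) ->
  nonzero_below 2 b -> q b = 0 ->
  sos 3 2 (fun v : nat -> R => q v * v 2%N ^+ 2 + 2 * c v * v 2%N + g v).
Proof.
move=> fq fc fg q_ge0 g_ge0 disc nzb qb.
have cb : c b = 0.
  by apply/eqP; rewrite -sqrf_eq0 eq_le sqr_ge0 andbT (le_trans (disc b)) // qb mul0r.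
have [A [fA A_ge0 qA]] := binary_double_factor nzb fq q_ge0 qb.
have [a AE] := form_const_eq fA.
have a_ge0 : 0 <= a by rewrite -(AE b).
have [m fm cm] := binary_factor nzb fc cb.
have fl := lin_through_form b; set l := lin_through b in qA cm fl.
have [a0|a_neq0] := eqVneq a 0.
  have sg : sos 3 2 g by apply: (@sos_widen 2) => //; exact: psd_binary_sos.
  apply: sos_ext sg => v.
  have q0 : q v = 0 by rewrite qA AE a0 mulr0.
  have /eqP : c v ^+ 2 = 0.
    by apply/eqP; rewrite eq_le sqr_ge0 andbT (le_trans (disc v)) // q0 mul0r.
  by rewrite sqrf_eq0 => /eqP c0; rewrite q0 c0; ring.
(* What remains after completing the square. *)
pose G v := g v - a^-1 * (m v * m v).
have fG : form 2 4 G by apply: form_sub fg (form_scale _ (form_mul fm fm)).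
have G_ge0 : forall v, 0 <= G v.
  apply: (binary_ge0_off_line nzb fG) => v; rewrite -/l.
  have -> : l v ^+ 2 * G v = a^-1 * (q v * g v - c v ^+ 2).
    by rewrite /G qA cm AE; field.
  by rewrite mulr_ge0 ?invr_ge0 // subr_ge0.
have sG : sos 3 2 G by apply: (@sos_widen 2) => //; exact: psd_binary_sos.
have fp : form 3 2 (fun v => l v * v 2%N + a^-1 * m v).
  apply: form_add; last by apply: form_scale; exact: form_widen fm.
  apply: (@form_mul _ 1 1); [exact: form_widen fl | exact: form_coord].
apply: sos_ext (sos_add (sos_scale a_ge0 (sos_sqr fp)) sG) => v.
by rewrite /G qA cm AE; field.
Qed.

(** Vanishing at (0,0,1) kills the coefficient of x^4; nonnegativity then kills
    that of x^3. *)
Lemma quartic_axis_zero_sos (F : (nat -> R) -> R) :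
  form 3 4 F -> (forall v, 0 <= F v) -> F (fun i => (i == 2%N)%:R) = 0 ->
  sos 3 2 F.
Proof.
move=> fF F_ge0 Fe.
have [g fg [F1 fF1 FE]] := form_split fF.
have [c fc [F2 fF2 F1E]] := form_split fF1.
have [q fq [F3 fF3 F2E]] := form_split fF2.
have [r fr [F4 fF4 F3E]] := form_split fF3.
have [k F4E] := form_const_eq fF4.
have FE4 v : F v = k * v 2%N ^+ 4 + r v * v 2%N ^+ 3 + q v * v 2%N ^+ 2
    + c v * v 2%N + g v by rewrite FE F1E F2E F3E F4E; ring.
have k0 : k = 0.
  have at0 d (H : (nat -> R) -> R) : form 2 d.+1 H -> H (fun i => (i == 2%N)%:R) = 0.
    by move=> fH; apply: (form_at_zero fH) => -[[|[|//]] _ /=]; rewrite eqxx.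
  move: Fe; rewrite FE4 (at0 _ _ fg) (at0 _ _ fc) (at0 _ _ fq) (at0 _ _ fr).
  by rewrite !mul0r !addr0 expr1n mulr1.
have F_ge0' v x : 0 <= r v * x ^+ 3 + q v * x ^+ 2 + c v * x + g v.
  have := F_ge0 (set_coord 2 v x); rewrite FE4 k0 mul0r add0r.
  rewrite (form_set_coord _ _ fr) (form_set_coord _ _ fq).
  by rewrite (form_set_coord _ _ fc) (form_set_coord _ _ fg).
have r0 v : r v = 0 := cubic_ge0 (F_ge0' v).
have [q_ge0 g_ge0 disc] : [/\ forall v, 0 <= q v, forall v, 0 <= g v
    & forall v, (2^-1 * c v) ^+ 2 <= q v * g v].
  have qp v : [/\ 0 <= q v, 0 <= g v & c v ^+ 2 <= 4 * q v * g v].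
    by apply: quadratic_ge0 => x; have := F_ge0' v x; rewrite r0 mul0r add0r.
  by split=> v; have [] := qp v => // _ _; lra.
have fc2 : form 2 3 (fun v => 2^-1 * c v) by exact: form_scale.
apply: (@sos_ext _ _
  (fun v => q v * v 2%N ^+ 2 + 2 * (2^-1 * c v) * v 2%N + g v)).
  by move=> v; rewrite FE4 k0 r0; field.
have [q_gt0|] := pselect (forall v, nonzero_below 2 v -> 0 < q v).
  exact: quartic_definite_sos.
move=> /existsNP[b /not_implyP[nzb /negP]]; rewrite -leNgt => qb.
apply: (@quartic_degenerate_sos _ _ _ b) => //.
by apply/eqP; rewrite eq_le qb q_ge0.
Qed.

(** Exchange the last coordinate with a coordinate i where b does not vanish,
    then replace the last basis vector by b. *)
Lemma coord_change_to_axis n (b : nat -> R) : nonzero_below n.+1 b ->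
  exists L L' : (nat -> R) -> nat -> R,
  [/\ forall i, (i < n.+1)%N -> form n.+1 1 (fun v => L v i),
      forall i, (i < n.+1)%N -> form n.+1 1 (fun v => L' v i),
      forall v, L (L' v) = v & L (fun i => (i == n)%:R) = b].
Proof.
case=> i lt_i bi.
(* The transposition of i and n. *)
pose sw j := if j == i then n else if j == n then i else j.
have swK j : sw (sw j) = j.
  rewrite /sw; have [->|ji] := eqVneq j i.
    by rewrite eqxx; have [->|] := eqVneq n i.
  have [->|jn] := eqVneq j n; first by rewrite eqxx.
  by rewrite (negPf ji) (negPf jn).
have sw_n j : (sw j == n) = (j == i).
  rewrite /sw; have [_|ji] := eqVneq j i; first by rewrite eqxx.
  have [jn|jn] := eqVneq j n; last by rewrite (negPf jn).
  by rewrite -jn eq_sym (negPf ji).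
have lt_sw j : (j < n.+1)%N -> (sw j < n.+1)%N.
  by rewrite /sw; case: eqP => // _; case: eqP.
pose L (v : nat -> R) j := (j != i)%:R * v (sw j) + b j * v n.
pose L' (v : nat -> R) j := if j == n then (b i)^-1 * v i
  else v (sw j) - b (sw j) / b i * v i.
exists L, L'; split.
- move=> j lt_j; apply: form_add; apply: form_scale; apply: form_coord => //.
  exact: lt_sw.
- move=> j lt_j; rewrite /L'; case: eqP => _.
    by apply: form_scale; exact: form_coord.
  apply: form_sub; first by apply: form_coord; exact: lt_sw.
  by apply: form_scale; exact: form_coord.
- move=> v; apply/funext => j; rewrite /L /L' eqxx sw_n swK.
  have [->|ji] := eqVneq j i; first by rewrite mul0r add0r mulrA divff // mul1r.
  by rewrite mul1r; field.
apply/funext => j; rewrite /L eqxx sw_n mulr1.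
by case: (j == i); rewrite ?mul0r ?mulr0 add0r.
Qed.

Theorem psd_ternary_quartic_sos (F : (nat -> R) -> R) :
  form 3 4 F -> (forall v, 0 <= F v) -> sos 3 2 F.
Proof.
move=> fF F_ge0.
pose s (v : nat -> R) := v 0%N ^+ 2 + v 1%N ^+ 2 + v 2%N ^+ 2.
have fs : form 3 2 s.
  by apply: form_add; [apply: form_add|]; apply: (@form_exp _ 1 2);
    exact: form_coord.
have s_gt0 v : nonzero_below 3 v -> 0 < s v ^+ 2.
  move=> nzv; rewrite exprn_gt0 // /s.
  have v2 i : 0 <= v i ^+ 2 := sqr_ge0 (v i).
  have := v2 0%N; have := v2 1%N; have := v2 2%N.
  by case: nzv => -[|[|[|//]]] _; rewrite -sqrf_eq0 => ne p2 p1 p0;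
    [have : 0 < v 0%N ^+ 2 | have : 0 < v 1%N ^+ 2 | have : 0 < v 2%N ^+ 2];
    rewrite ?lt_neqAle 1?eq_sym ?ne //; lra.
have fN : form 3 4 (fun v => s v ^+ 2) := form_exp 2 fs.
have [e [b [e_ge0 nzb le_F Fb]]] := touching_multiple fF fN F_ge0 s_gt0.
have [L [L' [fL fL' LK Lb]]] := coord_change_to_axis nzb.
have sL : sos 3 2 (fun v => F (L v) - e * s (L v) ^+ 2).
  apply: quartic_axis_zero_sos.
  - exact: form_comp fL (form_sub fF (form_scale e fN)).
  - by move=> v; rewrite subr_ge0.
  by rewrite Lb Fb subrr.
apply: sos_ext (sos_add (sos_scale e_ge0 (sos_sqr fs)) (sos_comp fL' sL)) => v.
by rewrite LK addrC subrK.
Qed.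

(** * Nonnegative forms in the three cases of Hilbert *)

(** With n at most 2, F is regarded as a binary form, and the extra variables
    of the squares are then set to 0. *)
Theorem psd_sos n d (F : (nat -> R) -> R) :
  ((n <= 2)%N /\ ~~ odd d) \/ d = 2 \/ (n = 3 /\ d = 4) ->
  form n d F -> (forall v, 0 <= F v) -> exists2 m, d = m.*2 & sos n m F.
Proof.
case=> [[le_n2 even_d]|[->|[-> ->]]] fF F_ge0; last first.
- by exists 2 => //; exact: psd_ternary_quartic_sos.
- by exists 1%N => //; exact: psd_quadratic_sos.
have dE : d = d./2.*2 by rewrite even_halfK.
exists d./2 => //; rewrite dE in fF.
have := psd_binary_sos (form_widen le_n2 fF) F_ge0.
pose cut (v : nat -> R) i := if (i < n)%N then v i else 0.
have fcut i : (i < 2)%N -> form n 1 (fun v => cut v i).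
  move=> _; have [lt_i|le_i] := ltnP i n.
    by apply: form_ext (form_coord lt_i) => v; rewrite /cut lt_i.
  by apply: form_ext (form_zero n 1) => v; rewrite /cut ltnNge le_i.
move=> /(sos_comp fcut); apply: sos_ext => v.
by apply: (form_local fF) => i lt_in; rewrite /cut lt_in.
Qed.

(** * From functions to polynomials *)

Local Notation homogeneous n d := (@ishomog1 n R d (@mdeg n)).
Local Notation meval_at v p := (meval (fun i : 'I_ _ => v (val i)) p).
Local Notation indet i := (mpolyX R (mnm1 i)).

Lemma form_prod n (I : Type) (s : seq I) (e : I -> nat)
    (F : I -> (nat -> R) -> R) :
  (forall i, form n (e i) (F i)) ->
  form n (\sum_(i <- s) e i) (fun v => \prod_(i <- s) F i v).
Proof.
move=> fF; elim: s => [|i s IH].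
  by rewrite big_nil; apply: form_ext (form_const n 1) => v; rewrite big_nil.
by rewrite big_cons; apply: form_ext (form_mul (fF i) IH) => v; rewrite big_cons.
Qed.

Lemma mpoly_form n d (p : mpoly.mpoly n R) :
  p \is homogeneous n d -> form n d (fun v => meval_at v p).
Proof.
move=> /dhomogP hp.
apply: (@form_ext _ _ (fun v => \sum_(m <- msupp p | m \in msupp p)
    mcoeff m p * \prod_(i < n) v i ^+ m i)).
  by move=> v; rewrite mevalE -big_seq.
apply: form_sum => m /hp <-; apply: form_scale; rewrite /= mdegE.
apply: form_prod => i.
by have := form_exp (m i) (form_coord (ltn_ord i)); rewrite muln1.
Qed.

Lemma form_mpoly n d (F : (nat -> R) -> R) : form n d F ->
  exists2 p : mpoly.mpoly n R, p \is homogeneous n d & forall v, F v = meval_at v p.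
Proof.
elim=> [c|e|e A B _ [p hp Ap] _ [q hq Bq]|e i A lt_in _ [p hp Ap]].
- exists (c *: 1); first by apply: dhomogZ; exact: dhomog1.
  by move=> v; rewrite mevalZ meval1 mulr1.
- by exists 0 => [|v]; [exact: dhomog0 | rewrite meval0].
- exists (p + q) => [|v]; first exact: dhomogD.
  by rewrite mevalD Ap Bq.
exists (indet (Ordinal lt_in) * p) => [|v].
  by apply: (@dhomogM _ _ _ 1) => //; rewrite dhomogX /= mdeg1.
by rewrite mevalM mevalXU Ap.
Qed.

Lemma base_expansion_inj N n (a b : 'I_n -> nat) :
  (forall i, a i < N)%N -> (forall i, b i < N)%N ->
  (\sum_(i < n) a i * N ^ i = \sum_(i < n) b i * N ^ i)%N -> a =1 b.
Proof.
elim: n a b => [|n IH] a b a_lt b_lt; first by move=> _ [].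
have N_gt0 : (0 < N)%N by apply: leq_ltn_trans (a_lt ord0).
have shift (c : 'I_n.+1 -> nat) : (\sum_(i < n.+1) c i * N ^ i
    = (\sum_(i < n) c (lift ord0 i) * N ^ i) * N + c ord0)%N.
  rewrite big_ord_recl /= muln1 addnC big_distrl /=; congr addn.
  by apply: eq_bigr => i _; rewrite expnSr mulnA.
rewrite !shift => E.
have E0 : a ord0 = b ord0.
  by have := congr1 (modn^~ N) E; rewrite /= !modnMDl !modn_small.
move=> i; case: (unliftP ord0 i) => [j ->|-> //].
apply: (IH (a \o lift ord0) (b \o lift ord0)) => [k|k|]; rewrite /= ?a_lt ?b_lt //.
by have := congr1 (divn^~ N) E; rewrite /= !divnMDl // !divn_small // !addn0.
Qed.

(** Kronecker substitution: with N above the degree, x_i -> t^(N^i) sends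
    distinct monomials of p to distinct powers of t, and the resulting univariate
    polynomial vanishes at every natural number. *)
Lemma mpoly_eval_eq0 n (p : mpoly.mpoly n R) :
  (forall v : nat -> R, meval_at v p = 0) -> p = 0.
Proof.
move=> p0; apply/eqP; rewrite -msupp_eq0; apply/eqP.
pose N := (\max_(m <- msupp p) mdeg m).+1.
pose k (m : multinom n) := (\sum_(i < n) m i * N ^ i)%N.
have deg_lt m (i : 'I_n) : m \in msupp p -> (m i < N)%N.
  move=> mp; rewrite ltnS; apply: leq_trans (leq_bigmax_seq _ mp isT).
  by rewrite mdegE (bigD1 i) //= leq_addr.
have k_inj : {in msupp p &, injective k}.
  move=> m m' mp mp' E; apply/mnmP.
  by apply: (base_expansion_inj _ _ E) => i; exact: deg_lt.
pose P : {poly R} := \sum_(m <- msupp p) mcoeff m p *: 'X^(k m).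
have P0 : P = 0.
  apply/eqP/negPn/negP => P_neq0.
  have := @max_poly_roots _ P [seq i%:R | i <- iota 0 (size P)] P_neq0.
  rewrite size_map size_iota ltnn => H; apply: notF; apply: H.
    apply/allP => x /mapP[t _ ->{x}]; apply/rootP.
    rewrite -[RHS](p0 (fun i => t%:R ^+ (N ^ i))) mevalE horner_sum.
    apply: eq_bigr => m _; rewrite hornerZ hornerXn; congr (_ * _).
    rewrite /k -prodrXr; apply: eq_bigr => i _.
    by rewrite -exprM mulnC.
  by rewrite map_inj_uniq ?iota_uniq //; exact: mulrIn (oner_neq0 _).
case E : (msupp p) => [//|m s].
have mp : m \in msupp p by rewrite E mem_head.
have := congr1 (fun q : {poly R} => q`_(k m)) P0.
rewrite coef0 coef_sum (bigD1_seq m) ?msupp_uniq //=.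
rewrite coefZ coefXn eqxx mulr1 big_seq_cond big1 => [|m' /andP[mp' ne]].
  by rewrite addr0 => /eqP; rewrite mcoeff_eq0 mp.
rewrite coefZ coefXn [_ == _](_ : _ = false) ?mulr0 //.
by apply/negbTE; apply: contra ne => /eqP/k_inj ->.
Qed.

Lemma sos_mpolys n m (F : (nat -> R) -> R) : sos n m F ->
  exists2 s : seq (mpoly.mpoly n R), {in s, forall p, p \is homogeneous n m} &
    forall v, F v = meval_at v (\sum_(p <- s) p ^+ 2).
Proof.
elim=> [|q A fq _ [s hs As]].
  by exists [::] => // v; rewrite big_nil meval0.
have [p hp qp] := form_mpoly fq.
exists (p :: s) => [r|v]; first by rewrite inE => /predU1P[->|/hs].
by rewrite big_cons mevalD !expr2 mevalM -qp As.
Qed.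

Lemma coercive_sos_of_seq n m (f : mpoly.mpoly n R) (s : seq (mpoly.mpoly n R)) :
  {in s, forall p, p \is homogeneous n m} -> f = \sum_(p <- s) p ^+ 2 ->
  (forall a : 'rV[complex R]_n, a != 0 -> exists2 p, p \in s &
    meval (a 0) (map_mpoly (real_complex R) p) != 0) ->
  coercive_sos f.
Proof.
move=> hs fE nzs; exists (size s), (fun j => s`_j); split.
- move=> j; apply/homogP; exists m; apply: hs; exact: mem_nth.
- by rewrite fE (big_nth 0) big_mkord.
case=> a /nzs[p ps pa] p0; move: pa; rewrite -(nth_index 0 ps).
by rewrite -index_mem in ps; rewrite (p0 (Ordinal ps)) eqxx.
Qed.

(** The squares of sqrt(e) x_i^m have no common complex zero but the origin.
    For m = 0 they are nonzero constants. *)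
Lemma coercive_of_psd_sub n m (e : R) (f : mpoly.mpoly n R) : 0 < e ->
  sos n m (fun v => meval_at v f - e * \sum_(i < n) (v i ^+ m) ^+ 2) ->
  coercive_sos f.
Proof.
move=> e_gt0 /sos_mpolys[s hs sE].
pose pw (i : 'I_n) : mpoly.mpoly n R := Num.sqrt e *: indet i ^+ m.
have pwE v i : meval_at v (pw i ^+ 2) = e * (v i ^+ m) ^+ 2.
  rewrite rmorphXn /= mevalZ rmorphXn /= mevalXU exprMn sqr_sqrtr //.
  exact: ltW.
apply: (@coercive_sos_of_seq _ m f (s ++ [seq pw i | i <- index_enum 'I_n])).
- move=> p; rewrite mem_cat => /orP[/hs //|/mapP[i _ ->]].
  apply: dhomogZ; rewrite -[X in ishomog1 X]mul1n; apply: dhomogMn.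
  by rewrite dhomogX /= mdeg1.
- apply/eqP; rewrite -subr_eq0; apply/eqP/mpoly_eval_eq0 => v.
  rewrite mevalB big_cat /= mevalD -sE big_map raddf_sum mulr_sumr /=.
  by rewrite (eq_bigr _ (fun i _ => pwE v i)); ring.
move=> a /rV0Pn[i ai]; exists (pw i).
  by rewrite mem_cat map_f ?orbT // mem_index_enum.
rewrite map_mpolyZ mevalZ !rmorphXn /= map_mpolyX mevalXU.
rewrite mulf_neq0 ?expf_neq0 //.
by rewrite fmorph_eq0 sqrtr_eq0 -ltNge.
Qed.

End PsdForms.

(** * Positive definite forms *)

Theorem mainTheorem4 (R : realType) (n d : nat)
    (hnd : (n <= 2 /\ ~~ odd d) \/ d = 2 \/ (n = 3 /\ d = 4)) :
  forall f : mpoly.mpoly n R,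
    psd_form d f -> positive_definite f -> coercive_sos f.
Proof.
move=> f [hf f_ge0] f_gt0.
pose F (v : nat -> R) := meval (fun i : 'I_n => v i) f.
have fF : form n d F := mpoly_form hf.
have F_row v : F v = meval ((\row_(i < n) v i)%R ord0) f.
  by apply: meval_eq => i; rewrite mxE.
have F_ge0 v : (0 <= F v)%R by rewrite F_row.
case: n => [|n] in hnd f hf f_ge0 f_gt0 @F fF F_row F_ge0 *.
  (* Without variables there is no nonzero point at all. *)
  have [m _ /sos_mpolys[s hs sE]] := psd_sos hnd fF F_ge0.
  apply: (coercive_sos_of_seq hs).
    apply/eqP; rewrite -GRing.subr_eq0; apply/eqP/mpoly_eval_eq0 => v.
    by rewrite mevalB -sE GRing.subrr.
  by move=> a; rewrite thinmx0 eqxx.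
have [m dE] : exists m, d = m.*2.
  by case: hnd => [[_ /even_halfK <-]|[->|[_ ->]]]; [exists d./2 | exists 1 | exists 2].
pose N (v : nat -> R) := (\sum_(i < n.+1) (v i ^+ m) ^+ 2)%R.
have fN : form n.+1 d N.
  rewrite dE; apply: form_sum => i _.
  have := form_exp 2 (form_exp m (form_coord (ltn_ord i))).
  by rewrite muln1 mul2n.
have N_gt0 v : nonzero_below n.+1 v -> (0 < N v)%R.
  case=> i lt_i vi; rewrite /N (bigD1 (Ordinal lt_i)) //=.
  rewrite ltr_wpDr //; first by apply: sumr_ge0 => j _; exact: sqr_ge0.
  by rewrite exprn_even_gt0 //= GRing.expf_neq0.
have [e [b [e_ge0 nzb le_F Fb]]] := touching_multiple fF fN F_ge0 N_gt0.
have e_gt0 : (0 < e)%R.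
  rewrite -(pmulr_lgt0 _ (N_gt0 b nzb)) -Fb F_row; apply: f_gt0.
  case: nzb => i lt_i bi; apply/rV0Pn.
  by exists (Ordinal lt_i); rewrite mxE.
have [|m' dE' sF] := psd_sos hnd (form_sub fF (form_scale e fN)).
  by move=> v; rewrite subr_ge0.
have mm' : m' = m by apply: double_inj; rewrite -dE'.
by rewrite mm' in sF; exact: (coercive_of_psd_sub e_gt0 sF).
Qed.
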